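(* Let $\mathcal{A}\in\mathbb{C}^{I_1\times\cdots\times I_N\times I_1\times\cdots\times I_N}$, let $\theta\in[0,2\pi]$, and let $\mathcal{X}_\theta\in\mathbb{C}^{I_1\times\cdots\times I_N}$ be a normalized (i.e. $\|\mathcal{X}_\theta\|=1$) eigentensor corresponding to the maximum eigenvalue of the Hermitian tensor $H(e^{i\theta}\mathcal{A})$. Then the complex number $\langle\mathcal{A}*_N\mathcal{X}_\theta,\mathcal{X}_\theta\rangle$ is a boundary point of $W(\mathcal{A})$ (as a subset of $\mathbb{C}$).
   Context: For $\mathcal{A}\in\mathbb{C}^{I_1\times\cdots\times I_N\times I_1\times\cdots\times I_N}$ and $\mathcal{X}\in\mathbb{C}^{I_1\times\cdots\times I_N}$, the Einstein product is $(\mathcal{A}*_N\mathcal{X})_{i_1\ldots i_N}=\sum_{k_1,\ldots,k_N}a_{i_1\ldots i_Nk_1\ldots k_N}x_{k_1\ldots k_N}$. $\langle\mathcal{X},\mathcal{Y}\rangle=\sum_{i_1,\ldots,i_N}x_{i_1\ldots i_N}\overline{y_{i_1\ldots i_N}}$ and $\|\mathcal{X}\|=\langle\mathcal{X},\mathcal{X}\rangle^{1/2}$. The conjugate transpose is $(\mathcal{A}^H)_{i_1\ldots i_Nj_1\ldots j_N}=\overline{a_{j_1\ldots j_Ni_1\ldots i_N}}$, and $H(\mathcal{A})=(\mathcal{A}+\mathcal{A}^H)/2$ is the Hermitian part. A number $\lambda\in\mathbb{C}$ is an eigenvalue of $\mathcal{A}$ with eigentensor $\mathcal{X}\ne 0$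 if $\mathcal{A}*_N\mathcal{X}=\lambda\mathcal{X}$; eigenvalues of a Hermitian tensor ($\mathcal{A}^H=\mathcal{A}$) are real. The numerical range is $W(\mathcal{A})=\{\langle\mathcal{A}*_N\mathcal{X},\mathcal{X}\rangle:\mathcal{X}\in\mathbb{C}^{I_1\times\cdots\times I_N},\|\mathcal{X}\|=1\}$. *)

(* Defs.v *)
From mathcomp Require Import all_boot all_order all_algebra.
From mathcomp Require Import complex.
From mathcomp Require Import all_classical all_reals all_analysis.
Set Implicit Arguments.
Unset Strict Implicit.
Unset Printing Implicit Defensive.
Import Order.TTheory GRing.Theory Num.Theory.
Import numFieldNormedType.Exports.
Local Open Scope classical_set_scope.
Local Open Scope ring_scope.

Definition multi_index (N : nat) (I : 'I_N -> nat) : finType :=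
  {dffun forall k : 'I_N, 'I_(I k)}.

(* R[i] carries module structures over both R and R[i]; the regular module
   R[i]^o makes *: the entrywise multiplication by complex scalars. *)
Definition tensor (R : realType) (N : nat) (I : 'I_N -> nat) :=
  {ffun multi_index I -> R[i]^o}.

(* An entry a_{i_1 ... i_N j_1 ... j_N} is indexed by the pair of multi-indices
   ((i_1, ..., i_N), (j_1, ..., j_N)). *)
Definition square_tensor (R : realType) (N : nat) (I : 'I_N -> nat) :=
  {ffun multi_index I * multi_index I -> R[i]^o}.

Section Tensors.
Variables (R : realType) (N : nat) (I : 'I_N -> nat).
Implicit Types (A : square_tensor R I) (X Y : tensor R I) (l : R[i]).

Definition einstein_prod A X : tensor R I :=
  [ffun i => \sum_(k : multi_index I) A (i, k) * X k].

Definition inner X Y : R[i] := \sum_(i : multi_index I) X i * (Y i : R[i])^*.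

Definition tnorm X : R[i] := sqrtC (inner X X).

Definition conj_transpose A : square_tensor R I :=
  [ffun ij => (A (ij.2, ij.1) : R[i])^*].

Definition hermitian_part A : square_tensor R I :=
  (2 : R[i])^-1 *: (A + conj_transpose A).

Definition eigentensor A l X : Prop :=
  X != 0 /\ einstein_prod A X = l *: X.

Definition tensor_eigenvalue A l : Prop := exists X, eigentensor A l X.

(* On R[i], x <= y means that y - x is a nonnegative real; on the eigenvalues
   of a Hermitian tensor, which are real, this is the usual order. *)
Definition max_eigenvalue A l : Prop :=
  tensor_eigenvalue A l /\ forall m : R[i], tensor_eigenvalue A m -> m <= l.

(* R[i]^o is R[i] with the topology of the complex modulus. *)
Definition numerical_range A : set R[i]^o :=
  [set z | exists X, tnorm X = 1 /\ z = inner (einstein_prod A X) X].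

End Tensors.

Definition expi (R : realType) (t : R) : R[i] := (cos t +i* sin t)%C.

Definition boundary (T : topologicalType) (B : set T) : set T :=
  closure B `\` interior B.

(* Main.v *)
(** Diagonalising the Hermitian tensor [H = H(expi theta A)] in an orthonormal
    basis gives [<H Y, Y> <= lambda] for every unit [Y], with equality at [X].
    As [<H Y, Y> = Re (expi theta <A Y, Y>)], the numerical range lies in the
    half-plane [Re (expi theta z) <= lambda], whose bounding line contains
    [<A X, X>]. *)

Require Import Defs.
From HB Require Import structures.
From mathcomp Require Import all_boot all_order all_algebra.
From mathcomp Require Import complex.
From mathcomp Require Import all_classical all_reals all_analysis.
Set Implicit Arguments.
Unset Strict Implicit.
Unset Printing Implicit Defensive.
Import Order.TTheory GRing.Theory Num.Theory.
Import numFieldNormedType.Exports.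
Local Open Scope classical_set_scope.
Local Open Scope ring_scope.
Local Open Scope sesquilinear_scope.

(** Spectral theorem: [M = P^* D P] with [P] unitary and [D] diagonal. In the coordinates [P v] the
    form becomes the sum of [d_i |(P v)_i|^2], and every [d_i], being an eigenvalue, is at most
    [l]. *)
Lemma hermitian_form_le (C : numClosedFieldType) (n : nat) (M : 'M[C]_n)
    (l : C) (v : 'cV[C]_n) :
  M \is hermsymmx ->
  (forall (a : C) (u : 'cV[C]_n), u != 0 -> M *m u = a *: u -> a <= l) ->
  (v ^t* *m M *m v) 0 0 <= l * (v ^t* *m v) 0 0.
Proof.
move=> /hermitian_normalmx/orthomx_spectralP.
set P := spectralmx M; set d := spectral_diag M => MP lmax.
have PU : P \is unitarymx := spectral_unitarymx M.
have PPt : P *m P ^t* = 1%:M by exact/unitarymxP.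
have PtP : P ^t* *m P = 1%:M by exact: mulmx1C.
rewrite invmx_unitary // in MP.
have d_le i : d 0 i <= l.
  (* Column [i] of [P^*] is an eigenvector for [d_i]; it is nonzero because [P] sends it to the
     [i]-th basis vector. *)
  apply: (lmax _ (col i (P ^t*))).
    apply/eqP => /(congr1 (mulmx P)); rewrite mulmx0 colE mulmxA PPt mul1mx.
    by move=> /matrixP/(_ i 0)/eqP; rewrite !mxE eqxx oner_eq0.
  rewrite colE MP !mulmxA -(mulmxA _ P) PPt mulmx1 -!colE.
  by apply/colP => j; rewrite mul_mx_diag !mxE mulrC.
have vM : v ^t* *m M *m v = (P *m v) ^t* *m diag_mx d *m (P *m v).
  by rewrite {1}MP trmx_mul map_mxM !mulmxA.
have vv : v ^t* *m v = (P *m v) ^t* *m (P *m v).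
  by rewrite trmx_mul map_mxM mulmxA -[_ *m P]mulmxA PtP mulmx1.
rewrite vM vv mul_mx_diag !mxE mulr_sumr.
apply: ler_sum => i _; rewrite !mxE mulrAC mulrC.
by rewrite ler_wpM2r // -normCKC exprn_ge0.
Qed.

(** Enumerating the multi-indices flattens tensors, which makes the spectral theorem for matrices
    available. *)
Definition tensor_col (R : realType) (N : nat) (I : 'I_N -> nat)
    (X : tensor R I) : 'cV[R[i]]_#|multi_index I| :=
  \col_i X (enum_val i).

Definition square_tensor_mx (R : realType) (N : nat) (I : 'I_N -> nat)
    (A : square_tensor R I) : 'M[R[i]]_#|multi_index I| :=
  \matrix_(i, j) A (enum_val i, enum_val j).

Lemma inner_mx (R : realType) (N : nat) (I : 'I_N -> nat)
    (X Y : tensor R I) :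
  inner X Y = ((tensor_col Y) ^t* *m tensor_col X) 0 0.
Proof.
rewrite mxE /inner (reindex (@enum_val (multi_index I) predT)) /=; last exact/onW_bij/enum_val_bij.
by apply: eq_bigr => i _; rewrite !mxE mulrC.
Qed.

Lemma einstein_prod_mx (R : realType) (N : nat) (I : 'I_N -> nat)
    (A : square_tensor R I) (X : tensor R I) :
  tensor_col (einstein_prod A X) = square_tensor_mx A *m tensor_col X.
Proof.
apply/colP => i; rewrite !mxE ffunE (reindex (@enum_val (multi_index I) predT)) /=; last first.
  exact/onW_bij/enum_val_bij.
by apply: eq_bigr => j _; rewrite !mxE.
Qed.

Lemma rayleigh_max_eigenvalue (R : realType) (N : nat) (I : 'I_N -> nat)
    (A : square_tensor R I) (l : R[i]) (Y : tensor R I) :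
  conj_transpose A = A -> max_eigenvalue A l ->
  inner (einstein_prod A Y) Y <= l * inner Y Y.
Proof.
move=> Aherm [_ lmax].
rewrite !inner_mx einstein_prod_mx mulmxA.
apply: hermitian_form_le.
  apply/is_hermitianmxP; rewrite expr0 scale1r.
  by apply/matrixP => i j; rewrite !mxE -[in LHS]Aherm ffunE.
(* Unflattening [u] gives an eigentensor of [A] for [a], so maximality of [l] bounds [a]. *)
move=> a u u0 Mu; apply: lmax; exists [ffun k => u (enum_rank k) 0].
have uE : tensor_col [ffun k => u (enum_rank k) 0] = u.
  by apply/colP => i; rewrite mxE ffunE enum_valK.
split.
  apply: contraNneq u0 => /ffunP X0; apply/eqP/colP => i.
  by have := X0 (enum_val i); rewrite !ffunE enum_valK mxE.
apply/ffunP => k; have /colP/(_ (enum_rank k)) := Mu.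
by rewrite -{1}uE -einstein_prod_mx !mxE enum_rankK !ffunE.
Qed.

Lemma conj_transpose_hermitian_part (R : realType) (N : nat)
    (I : 'I_N -> nat) (A : square_tensor R I) :
  conj_transpose (hermitian_part A) = hermitian_part A.
Proof.
apply/ffunP => -[i j]; rewrite !ffunE /= rmorphM rmorphD /= conjCK addrC.
by rewrite fmorphV /= conjC_nat.
Qed.

Lemma inner_conj_transpose (R : realType) (N : nat) (I : 'I_N -> nat)
    (A : square_tensor R I) (X : tensor R I) :
  inner (einstein_prod (conj_transpose A) X) X
    = (inner (einstein_prod A X) X)^*.
Proof.
rewrite /inner rmorph_sum /=.
under eq_bigr do rewrite ffunE mulr_suml.
under [RHS]eq_bigr do rewrite ffunE mulr_suml rmorph_sum /=.
rewrite exchange_big /=; apply: eq_bigr => i _; apply: eq_bigr => j _.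
by rewrite ffunE /= !rmorphM /= conjCK mulrAC.
Qed.

Lemma inner_hermitian_part (R : realType) (N : nat) (I : 'I_N -> nat)
    (c : R[i]) (A : square_tensor R I) (X : tensor R I) :
  inner (einstein_prod (hermitian_part (c *: A)) X) X
    = 'Re (c * inner (einstein_prod A X) X).
Proof.
have innerZ (b : R[i]) B :
    inner (einstein_prod (b *: B) X) X = b * inner (einstein_prod B X) X.
  rewrite mulr_sumr; apply: eq_bigr => i _; rewrite !ffunE mulrA mulr_sumr.
  by congr (_ * _); apply: eq_bigr => k _; rewrite ffunE -mulrA.
have innerD B B' : inner (einstein_prod (B + B') X) X
    = inner (einstein_prod B X) X + inner (einstein_prod B' X) X.
  rewrite -big_split /=; apply: eq_bigr => i _.
  rewrite !ffunE -mulrDl -big_split.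
  by congr (_ * _); apply: eq_bigr => k _; rewrite ffunE mulrDl.
rewrite /hermitian_part innerZ innerD inner_conj_transpose innerZ.
by rewrite ReE mulrC.
Qed.

Lemma norm_expi (R : realType) (t : R) : `|expi t| = 1.
Proof. by rewrite normc_def /= cos2Dsin2 sqrtr1. Qed.

Lemma tnorm1_inner (R : realType) (N : nat) (I : 'I_N -> nat)
    (X : tensor R I) : tnorm X = 1 -> inner X X = 1.
Proof. by move=> X1; rewrite -[inner X X]sqrtCK -/(tnorm X) X1 expr1n. Qed.

(* A supporting line touches a set only at boundary points: from [z] one leaves
   the half-plane [Re (c w) <= Re (c z)] by moving in the direction [c^*]. *)
Lemma support_boundary (R : realType) (B : set R[i]^o) (c : R[i]) (z : R[i]^o) :
  `|c| = 1 -> B z -> (forall w, B w -> 'Re (c * w) <= 'Re (c * z)) ->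
  boundary B z.
Proof.
move=> c1 Bz Bmax; split; first exact: subset_closure.
move=> /nbhs_ballP[e /= e0 eB].
have e2 : 0 < e / 2 by rewrite divr_gt0.
have /eB/Bmax : ball z e (z + (e / 2 * c^* : R[i]^o)).
  rewrite -ball_normE /= opprD addrA subrr sub0r normrN normrM norm_conjC c1.
  by rewrite mulr1 gtr0_norm // ltr_pdivrMr // ltr_pMr // ltr1n.
(* Since [c c^* = |c|^2 = 1], a move of length [e / 2] raises the real part by exactly [e / 2]. *)
have -> : c * (z + e / 2 * c^*) = c * z + e / 2.
  by rewrite mulrDr mulrCA -normCK c1 expr1n mulr1.
rewrite raddfD /= gerDl (Creal_ReP _ _) ?gtr0_real //.
by rewrite lt_geF.
Qed.

Theorem theorem3p2 (R : realType) (N : nat) (I : 'I_N -> nat)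
    (A : square_tensor R I) (theta : R) (lambda : R[i]) (X : tensor R I)
    (htheta : 0 <= theta <= 2 * pi)
    (hlambda : max_eigenvalue (hermitian_part (expi theta *: A)) lambda)
    (hX : eigentensor (hermitian_part (expi theta *: A)) lambda X)
    (hX1 : tnorm X = 1) :
  boundary (numerical_range A) (inner (einstein_prod A X) X).
Proof.
apply: (support_boundary (norm_expi theta)); first by exists X.
move=> _ [Y [/tnorm1_inner Y1 ->]].
(* The bound is attained at [X]: [<H X, X> = lambda <X, X> = lambda]. *)
have -> : 'Re (expi theta * inner (einstein_prod A X) X) = lambda.
  rewrite -inner_hermitian_part hX.2 -[RHS]mulr1 -(tnorm1_inner hX1).
  by rewrite mulr_sumr; apply: eq_bigr => i _; rewrite ffunE -mulrA.
(* Writing [lambda] as [lambda <Y, Y>] gives the homogeneous form of the Rayleigh bound. *)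
rewrite -inner_hermitian_part -[lambda]mulr1 -Y1.
apply: rayleigh_max_eigenvalue => //.
exact: conj_transpose_hermitian_part.
Qed.
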